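(* Let $L$ be a compactly generated multiplicative lattice in which the top element $1$ is compact and every finite product of compact elements is compact, and suppose $L$ is a $szi$-multiplicative lattice. An element $p$ of $L$ is $z$-prime if and only if $p$ is a $z$-element and $p$ is a prime element of $L$.
   Context: A multiplicative lattice is a complete lattice $(L,\leqslant,0,1)$ endowed with an associative, commutative multiplication which distributes over arbitrary joins and has $1$ as multiplicative identity. An element $c\in L$ is compact if for any $\{x_\lambda\}_{\lambda\in\Lambda}\subseteq L$, $c\leqslant\bigvee_{\lambda\in\Lambda}x_\lambda$ implies $c\leqslant\bigvee_{i=1}^n x_{\lambda_i}$ for some $n\in\mathbb{N}^+$ and $\lambda_1,\dots,\lambda_n\in\Lambda$; $L$ is compactly generated if every element of $L$ is a join of compact elements. An element $x$ is proper if $x\neq 1$. A proper element $m$ is maximal if $m\leqslant x$ and $x<1$ imply $m=x$, for all $x\in L$; $\mathcal{M}(L)$ is the set of maximal elements. A proper element $p$ is prime if $xy\leqslant p$ implies $x\leqslant p$ or $y\leqslant p$, for all $x,y\in L$. For $a\in L$ put $\mathcal{M}_a=\{m\in\mathcal{M}(L)\mid a\leqslant m\}$ and $\mathsf{m}_a=\bigwedge\mathcal{M}_a$ (the empty meet is $1$). An element $x\in L$ is a $z$-element if for all $a,b\in L$, $\mathcal{M}_a=\mathcal{M}_b$ and $b\leqslant x$ imply $a\leqslant x$. $L$ is a $szi$-multiplicative lattice if $(\mathsf{m}_a)^2=\mathsf{m}_a$ for every $a\in L$. A proper $z$-element $p$ is $z$-prime if for all $z$-elements $a,b$ of $L$,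 $ab\leqslant p$ implies $a\leqslant p$ or $b\leqslant p$. *)

(* Defs.v *)
From HB Require Import structures.
From mathcomp Require Import all_boot all_order.
From mathcomp Require Import boolp classical_sets.

Set Implicit Arguments.
Unset Strict Implicit.
Unset Printing Implicit Defensive.

Import Order.TTheory.

Local Open Scope classical_set_scope.
Local Open Scope order_scope.

HB.mixin Record TBLattice_isComplete d L of Order.TBLattice d L := {
  supremums_neq0 : forall A : set L, supremums A !=set0;
  infimums_neq0 : forall A : set L, infimums A !=set0;
}.

#[short(type="completeLatticeType")]
HB.structure Definition CompleteLattice d :=
  {L of TBLattice_isComplete d L & Order.TBLattice d L}.

(* The defaults are the values at the empty set: the empty join is 0 = \bot
   and the empty meet is 1 = \top. *)
Definition bigjoin d (L : completeLatticeType d) (A : set L) : L :=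
  supremum \bot A.
Definition bigmeet d (L : completeLatticeType d) (A : set L) : L :=
  infimum \top A.

HB.mixin Record CompleteLattice_isMultiplicative d L
    of CompleteLattice d L := {
  lmul : L -> L -> L;
  lmulA : associative lmul;
  lmulC : commutative lmul;
  lmul1x : left_id (\top : L) lmul;
  lmul_bigjoinr : forall (x : L) (A : set L),
    lmul x (bigjoin A) = bigjoin [set lmul x a | a in A];
}.

#[short(type="multLatticeType")]
HB.structure Definition MultLattice d :=
  {L of CompleteLattice_isMultiplicative d L & CompleteLattice d L}.

HB.instance Definition _ d (L : multLatticeType d) :=
  Monoid.isComLaw.Build L \top (@lmul d L) lmulA lmulC lmul1x.

Section MultLatticeDefs.
Context d (L : multLatticeType d).
Implicit Types a b c m p x y : L.

(* Since the finite subfamily is nonempty, the family must be as well: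
   otherwise \bot would not be compact. *)
Definition compact_elt c : Prop :=
  forall A : set L, A !=set0 -> c <= bigjoin A ->
    exists (n : nat) (x : 'I_n.+1 -> L),
      (forall i, A (x i)) /\ c <= \join_(i < n.+1) x i.

Definition compactly_generated : Prop :=
  forall x, exists2 A : set L, A `<=` compact_elt & x = bigjoin A.

Definition proper_elt x : Prop := x <> \top.

Definition maximal_elt m : Prop :=
  proper_elt m /\ forall x, m <= x -> x < \top -> m = x.

Definition prime_elt p : Prop :=
  proper_elt p /\ forall x y, lmul x y <= p -> x <= p \/ y <= p.

Definition maximals_above a : set L := [set m | maximal_elt m /\ a <= m].

Definition meet_maximals a : L := bigmeet (maximals_above a).

Definition z_element x : Prop :=
  forall a b, maximals_above a = maximals_above b -> b <= x -> a <= x.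

Definition szi : Prop :=
  forall a, lmul (meet_maximals a) (meet_maximals a) = meet_maximals a.

Definition z_prime p : Prop :=
  [/\ proper_elt p, z_element p &
      forall a b, z_element a -> z_element b ->
        lmul a b <= p -> a <= p \/ b <= p].

End MultLatticeDefs.

Arguments compactly_generated {d} L.
Arguments szi {d} L.

(* Main.v *)
(** For every [x], the meet [m_x] of the maximal elements above [x] is a
    z-element lying above [x], and it lies below every z-element above [x].
    Maximal elements are prime, so a maximal element above [xy] is above [x]
    or above [y]; hence [m_x m_y <= m_(xy)].  If [p] is z-prime and
    [xy <= p], then [m_x m_y <= m_(xy) <= p], so [m_x <= p] or [m_y <= p]. *)

Require Import Defs.
From mathcomp Require Import all_boot all_order.
From mathcomp Require Import boolp classical_sets.

Set Implicit Arguments.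
Unset Strict Implicit.
Unset Printing Implicit Defensive.

Import Order.TTheory.

Local Open Scope classical_set_scope.
Local Open Scope order_scope.

Section CompleteLattice.
Context d (L : completeLatticeType d).
Implicit Types (A : set L) (x y : L).

Lemma bigmeet_lb A x : A x -> bigmeet A <= x.
Proof.
move=> Ax; rewrite /bigmeet /infimum; case: eqP => [A0|_].
  by rewrite A0 in Ax.
have [z inf_z] := infimums_neq0 A.
by case: xgetP => [y _ [lbA _]|/(_ _ inf_z) //]; exact: lbA.
Qed.

Lemma bigmeet_glb A x : (forall y, A y -> x <= y) -> x <= bigmeet A.
Proof.
(* Both fallback branches, for an empty [A] and for a failed choice by [xget], return [\top], which
   lies above [x]. *)
move=> lbx; rewrite /bigmeet /infimum; case: eqP => [_|_]; first exact: lex1.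
by case: xgetP => [y _ [_ glbA]|_]; [exact: glbA|exact: lex1].
Qed.

(** Transfers distributivity from set-indexed joins, where it is an axiom, to binary joins. *)
Lemma bigjoin2 x y : bigjoin [set x; y] = x `|` y.
Proof.
rewrite /bigjoin /supremum; case: eqP => [xy0|_].
  have : [set x; y] x by left.
  by rewrite xy0.
have sup_xy : supremums [set x; y] (x `|` y).
  split=> [z [->|->]|z ubz]; [exact: leUl|exact: leUr|].
  by rewrite leUx !ubz //=; [right|left].
case: xgetP => [z _ sup_z|/(_ _ sup_xy) //].
exact: is_subset1_supremums sup_z sup_xy.
Qed.

End CompleteLattice.

Section MultLattice.
Context d (L : multLatticeType d).
Implicit Types a b m p x y z : L.

Lemma lmulUr x y z : lmul x (y `|` z) = lmul x y `|` lmul x z.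
Proof. by rewrite -!bigjoin2 lmul_bigjoinr image_setU !image_set1. Qed.

Lemma lmulUl x y z : lmul (y `|` z) x = lmul y x `|` lmul z x.
Proof. by rewrite !(lmulC _ x) lmulUr. Qed.

Lemma lmul_lel x y z : y <= z -> lmul x y <= lmul x z.
Proof. by move=> /join_idPl <-; rewrite lmulUr leUr. Qed.

Lemma lmul_lexl x y : lmul x y <= x.
Proof. by apply: le_trans (lmul_lel x (lex1 y)) _; rewrite lmulC lmul1x. Qed.

Lemma lmul_lexr x y : lmul x y <= y.
Proof. by rewrite lmulC lmul_lexl. Qed.

(** If [m]|[x] is not [\top], it is a proper element above [m], hence equal to [m]. *)
Lemma maximal_join m x : maximal_elt m -> x <= m \/ m `|` x = \top.
Proof.
case=> _ maxm; have [->|mx_neq1] := eqVneq (m `|` x) \top; first by right.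
by left; rewrite (maxm (m `|` x)) ?leUl ?leUr ?ltx1.
Qed.

Lemma maximal_prime m : maximal_elt m -> prime_elt m.
Proof.
move=> maxm; split=> [|x y xy_le_m]; first by case: maxm.
have [|mx1] := maximal_join x maxm; first by left.
have [|my1] := maximal_join y maxm; first by right.
(* Properness of [m] is contradicted by writing [\top] as the product of [m]|[x] and [m]|[y]: once
   expanded, each term has a factor [m] or is [lmul x y], so it is below [m]. *)
case: maxm => + _; case; apply/eqP; rewrite -le1x.
rewrite -(lmul1x \top) -{1}mx1 -my1 lmulUl !leUx lmul_lexl /=.
by rewrite lmulUr leUx lmul_lexr.
Qed.

Lemma le_meet_maximals x : x <= meet_maximals x.
Proof. by apply: bigmeet_glb => m []. Qed.

Lemma le_meet_maximalsE a x :
  (a <= meet_maximals x) <-> (maximals_above x `<=` maximals_above a).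
Proof.
split=> [ax m xm|xa]; last by apply: bigmeet_glb => m /xa[].
by split; [case: xm|exact: le_trans ax (bigmeet_lb xm)].
Qed.

Lemma maximals_above_meet x :
  maximals_above (meet_maximals x) = maximals_above x.
Proof.
apply/seteqP; split; last exact/le_meet_maximalsE.
by move=> m [maxm]; split=> //; apply: le_trans (le_meet_maximals x) _.
Qed.

(** Whether [a] lies below [meet_maximals x] depends only on the set of maximal elements above
    [a]. *)
Lemma z_element_meet_maximals x : z_element (meet_maximals x).
Proof. by move=> a b ab /le_meet_maximalsE; rewrite -ab => /le_meet_maximalsE. Qed.

(** The same maximal elements lie above [x] and [meet_maximals x], so the z-property of [p] applies
    to this pair. *)
Lemma meet_maximals_le x p : z_element p -> x <= p -> meet_maximals x <= p.
Proof. by move=> zp; apply: zp; exact: maximals_above_meet. Qed.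

Lemma lmul_meet_maximals x y :
  lmul (meet_maximals x) (meet_maximals y) <= meet_maximals (lmul x y).
Proof.
apply: bigmeet_glb => m [maxm xy_le_m].
have [_ /(_ _ _ xy_le_m)[x_le_m|y_le_m]] := maximal_prime maxm.
  exact: le_trans (lmul_lexl _ _) (bigmeet_lb _).
exact: le_trans (lmul_lexr _ _) (bigmeet_lb _).
Qed.

Lemma z_prime_prime p : z_prime p -> prime_elt p.
Proof.
case=> p_proper zp p_prime; split=> // x y xy_le_p.
have mxy_le_p := le_trans (lmul_meet_maximals x y) (meet_maximals_le zp xy_le_p).
have zm := @z_element_meet_maximals.
have [mx|my] := p_prime _ _ (zm x) (zm y) mxy_le_p.
  by left; apply: le_trans (le_meet_maximals x) mx.
by right; apply: le_trans (le_meet_maximals y) my.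
Qed.

End MultLattice.

Theorem proposition5p6 (d : Order.disp_t) (L : multLatticeType d)
  (L_cgen : compactly_generated L)
  (top_compact : compact_elt (\top%O : L))
  (prod_compact : forall s : seq L, (forall c, c \in s -> compact_elt c) ->
     compact_elt (\big[@lmul d L / \top%O]_(c <- s) c))
  (L_szi : szi L) (p : L) :
  z_prime p <-> z_element p /\ prime_elt p.
Proof.
split=> [zp|[zp [p_proper p_prime]]].
  by split; [case: zp|exact: z_prime_prime].
(* Primeness for all pairs is specialised to pairs of z-elements. *)
by split=> // a b _ _; exact: p_prime.
Qed.
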